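(* Let ${}^t\nabla$, $t\in\mathbb{R}$, be a smooth one-parameter family of connections on a manifold $M$. Then the equation $$\dot\Gamma(X,Y)=\lim_{\varepsilon\to0}\frac{{}^{t+\varepsilon}\nabla_XY-{}^t\nabla_XY}{\varepsilon},$$ where $X,Y$ are arbitrary vector fields on $M$, defines a time-dependent $(2,1)$-tensor field on $M$.
   Context: All manifolds and maps are smooth. A connection on a manifold is a linear connection on its tangent bundle. A one-parameter family of connections is smooth if its Christoffel symbols $\Gamma_{ij}^k(t,x)$ in any coordinate chart are smooth functions of $(t,x)$. A $(2,1)$-tensor field means a tensor field twice covariant and once contravariant (a $C^\infty(M)$-bilinear map $\mathfrak{X}(M)\times\mathfrak{X}(M)\to\mathfrak{X}(M)$); time-dependent means a smooth family of such tensor fields parametrized by $t\in\mathbb{R}$. The limit is taken pointwise, in each tangent space $\mathrm{T}_pM$. *)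

(* Defs.v *)
From HB Require Import structures.
From mathcomp Require Import all_boot all_order all_algebra.
From mathcomp Require Import all_classical all_reals topology normedtype derive.
Set Implicit Arguments.
Unset Strict Implicit.
Unset Printing Implicit Defensive.
Import Order.TTheory GRing.Theory Num.Theory.
Import numFieldNormedType.Exports.
Local Open Scope classical_set_scope.
Local Open Scope ring_scope.

(* C^k on an open set U.  In finite dimension, a map all of whose directional
   derivatives exist and are C^k is C^(k+1), so this is the usual notion on the
   spaces R^n and R x R^n used below. *)
Fixpoint Ck_on (R : realType) (V W : normedModType R) (k : nat) (U : set V)
    (f : V -> W) : Prop :=
  (forall x, U x -> {for x, continuous f}) /\
  (if k is k'.+1 then
     forall v, (forall x, U x -> derivable f x v) /\ Ck_on k' U ('D_v f)
   else True).

Definition smooth_on (R : realType) (V W : normedModType R) (U : set V)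
    (f : V -> W) : Prop := forall k, Ck_on k U f.

(* A chart is a homeomorphism between the open sets cdom of M and cimg of R^n;
   cmap and cinv are total functions whose values outside these sets are
   irrelevant. *)
Record chart (R : realType) (n : nat) (M : topologicalType) := Chart {
  cdom : set M;
  cmap : M -> 'rV[R]_n;
  cinv : 'rV[R]_n -> M;
  cdom_open : open cdom;
  cimg_open : open (cmap @` cdom);
  cmapK : forall p, cdom p -> cinv (cmap p) = p;
  cmap_continuous : forall p, cdom p -> {for p, continuous cmap};
  cinv_continuous : forall x, (cmap @` cdom) x -> {for x, continuous cinv} }.

Definition cimg (R : realType) (n : nat) (M : topologicalType)
  (c : chart R n M) : set 'rV[R]_n := cmap c @` cdom c.

Definition transition (R : realType) (n : nat) (M : topologicalType)
  (c d : chart R n M) : 'rV[R]_n -> 'rV[R]_n := cmap d \o cinv c.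

Definition compatible (R : realType) (n : nat) (M : topologicalType)
    (c d : chart R n M) : Prop :=
  smooth_on (cmap c @` (cdom c `&` cdom d)) (transition c d) /\
  smooth_on (cmap d @` (cdom c `&` cdom d)) (transition d c).

Record manifold (R : realType) (n : nat) := Manifold {
  carrier :> topologicalType;
  manifold_hausdorff : hausdorff_space carrier;
  manifold_second_countable : @second_countable carrier;
  atlas : set (chart R n carrier);
  atlas_cover : forall p, exists c, atlas c /\ cdom c p;
  atlas_compatible : forall c d, atlas c -> atlas d -> compatible c d;
  atlas_maximal : forall c, (forall d, atlas d -> compatible c d) -> atlas c }.

Definition chart_around (R : realType) (n : nat) (M : manifold R n) (p : M)
  : set (chart R n M) := [set c | atlas c /\ cdom c p].

(* A tangent vector at p is the family of its coordinate vectors in all the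
   charts around p, related by the Jacobians of the transition maps.  The
   coordinates in the other charts are set to 0, so that equality of tangent
   vectors is Leibniz equality. *)
Definition tangent_vector (R : realType) (n : nat) (M : manifold R n) : Type :=
  chart R n M -> 'rV[R]_n.

HB.instance Definition _ (R : realType) (n : nat) (M : manifold R n) :=
  GRing.Lmodule.on (tangent_vector M).

Definition tangent_space (R : realType) (n : nat) (M : manifold R n) (p : M)
  : set (tangent_vector M) :=
  [set v | (forall c, ~ chart_around p c -> v c = 0) /\
           (forall c d, chart_around p c -> chart_around p d ->
              v d = 'D_(v c) (transition c d) (cmap c p))].

(* Convergence in the finite-dimensional space T_pM, whose topology is the one
   transported from R^n by the coordinates in any chart around p. *)
Definition tangent_cvg (R : realType) (n : nat) (M : manifold R n) (p : M)
    (T : Type) (F : set_system T) (v : T -> tangent_vector M)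
    (l : tangent_vector M) : Prop :=
  forall c, chart_around p c -> v s c @[s --> F] --> l c.

Definition smooth_function (R : realType) (n : nat) (M : manifold R n)
    (f : M -> R) : Prop :=
  forall c, atlas c -> smooth_on (cimg c) (f \o cinv c : 'rV[R]_n -> R^o).

Definition section (R : realType) (n : nat) (M : manifold R n) : Type :=
  M -> tangent_vector M.

HB.instance Definition _ (R : realType) (n : nat) (M : manifold R n) :=
  GRing.Lmodule.on (section M).

Definition vector_field (R : realType) (n : nat) (M : manifold R n)
    (X : section M) : Prop :=
  (forall p, tangent_space p (X p)) /\
  (forall c, atlas c -> smooth_on (cimg c) (fun x => X (cinv c x) c)).

Definition fscale (R : realType) (n : nat) (M : manifold R n) (f : M -> R)
  (X : section M) : section M := fun p => f p *: X p.

(* The derivative X f; the choice of the chart around p does not matter. *)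
Definition field_derive (R : realType) (n : nat) (M : manifold R n)
    (X : section M) (f : M -> R) (p : M) : R :=
  let c := projT1 (cid (atlas_cover p)) in
  'D_(X p c) (f \o cinv c : 'rV[R]_n -> R^o) (cmap c p).

(* Maps X(M) x X(M) -> X(M) are represented by functions on arbitrary sections,
   of which only the values on vector fields matter. *)
Record connection (R : realType) (n : nat) (M : manifold R n) := Connection {
  cov :> section M -> section M -> section M;
  cov_field : forall X Y, vector_field X -> vector_field Y ->
    vector_field (cov X Y);
  cov_linear_l : forall f X X' Y, smooth_function f ->
    vector_field X -> vector_field X' -> vector_field Y ->
    cov (fscale f X + X') Y = fscale f (cov X Y) + cov X' Y;
  cov_linear_r : forall (a : R) X Y Y',
    vector_field X -> vector_field Y -> vector_field Y' ->
    cov X (a *: Y + Y') = a *: cov X Y + cov X Y';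
  cov_leibniz : forall f X Y, smooth_function f ->
    vector_field X -> vector_field Y ->
    cov X (fscale f Y) = fscale (field_derive X f) Y + fscale f (cov X Y) }.

Record tensor21 (R : realType) (n : nat) (M : manifold R n) := Tensor21 {
  tensor :> section M -> section M -> section M;
  tensor_field : forall X Y, vector_field X -> vector_field Y ->
    vector_field (tensor X Y);
  tensor_linear_l : forall f X X' Y, smooth_function f ->
    vector_field X -> vector_field X' -> vector_field Y ->
    tensor (fscale f X + X') Y = fscale f (tensor X Y) + tensor X' Y;
  tensor_linear_r : forall f X Y Y', smooth_function f ->
    vector_field X -> vector_field Y -> vector_field Y' ->
    tensor X (fscale f Y + Y') = fscale f (tensor X Y) + tensor X Y' }.

(* X is a vector field on M extending the coordinate field d/dx^i of the chart c
   from a neighbourhood of p. *)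
Definition extends_coordinate_field (R : realType) (n : nat) (M : manifold R n)
    (c : chart R n M) (i : 'I_n) (p : M) (X : section M) : Prop :=
  vector_field X /\ \forall q \near p, X q c = delta_mx 0 i.

(* G i j k are the coefficients of B in the chart c, that is
   B (d/dx^i) (d/dx^j) = \sum_k (G i j k) d/dx^k: the Christoffel symbols when B
   is a connection, the components when B is a (2,1)-tensor field.  The
   coordinate fields are only defined on cdom c, but such a B is local, so its
   value at p is computed with global fields extending them near p. *)
Definition coefficients (R : realType) (n : nat) (M : manifold R n)
    (B : section M -> section M -> section M) (c : chart R n M)
    (G : 'I_n -> 'I_n -> 'I_n -> 'rV[R]_n -> R) : Prop :=
  forall p, cdom c p -> forall i j X Y,
    extends_coordinate_field c i p X -> extends_coordinate_field c j p Y ->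
    forall k, B X Y p c 0 k = G i j k (cmap c p).

Definition smooth_family (R : realType) (n : nat) (M : manifold R n)
    (B : R -> section M -> section M -> section M) : Prop :=
  forall c : chart R n M, atlas c ->
  exists G : 'I_n -> 'I_n -> 'I_n -> R * 'rV[R]_n -> R,
    (forall t, coefficients (B t) c (fun i j k x => G i j k (t, x))) /\
    (forall i j k, smooth_on ([set: R] `*` cimg c)
                     (G i j k : (R^o * 'rV[R]_n)%type -> R^o)).

(* Main.v *)
Require Import Defs.
From HB Require Import structures.
From mathcomp Require Import all_boot all_order all_algebra.
From mathcomp Require Import all_classical all_reals topology normedtype landau.
From mathcomp Require Import sequences derive realfun exp.
From mathcomp Require Import ring lra.
Set Implicit Arguments.
Unset Strict Implicit.
Unset Printing Implicit Defensive.
Import Order.TTheory GRing.Theory Num.Theory.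
Import numFieldNormedType.Exports.
Local Open Scope classical_set_scope.
Local Open Scope ring_scope.

(* In a difference quotient of two connections the Leibniz terms cancel, so it
   is a (2,1)-tensor field.  With a cutoff chi supported in a chart c and the
   global frame E_i = chi d/dx^i, every field X satisfies
   chi^2 X = \sum_i (chi X^i) E_i; hence a tensor field B is determined at p by
   its components, B(X, Y)^k = \sum_(i, j) X^i Y^j B_ij^k.  Applied to the
   difference quotients, whose components are those of the Christoffel symbols,
   this gives the limit \sum_(i, j) X^i Y^j dG_ij^k/dt in the chart c.  The
   limit is smooth because dG/dt is, it lies in T_pM because T_pM is a closed
   subspace, and linearity over functions passes to the limit. *)

(** * Maps of class C^k *)

(** Connections and tensor fields take global vector fields as arguments, whereas d/dx^i and the
    coordinates X^i only make sense on a chart. Hence the square of chi: one factor extends the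
    coefficient X^i by 0, the other extends d/dx^i. The expansion in the frame requires linearity
    over functions in both arguments, so it is applied to the difference quotients and not to the
    connections themselves. Smoothness is formulated by iterated directional derivatives, which does
    not contain linearity in the direction or the chain rule. Both are derived from the continuity
    of the derivatives through the mean value theorem; they make Jacobians act linearly on tangent
    vectors and make the cut-off fields smooth in every chart. The limit is defined in each chart
    separately, without a choice, so the local formula serves only for existence, smoothness and the
    components. *)

Lemma Ck_on_sub (R : realType) (V W : normedModType R) k (U U' : set V)
    (f : V -> W) :
  U' `<=` U -> Ck_on k U f -> Ck_on k U' f.
Proof.
move=> sU; elim: k f => [|k IH] f /= [cf Df]; split; do ?by move=> x /sU /cf.
  by [].
move=> v; have [dv Dv] := Df v; split; first by move=> x /sU /dv.
exact: IH.
Qed.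

(** Continuity and derivatives are those of the total function at the points of the set, so each
    condition is pointwise. This is what allows gluing. *)
Lemma Ck_on_setU (R : realType) (V W : normedModType R) k (U U' : set V)
    (f : V -> W) :
  Ck_on k U f -> Ck_on k U' f -> Ck_on k (U `|` U') f.
Proof.
elim: k f => [|k IH] f /= [cf Df] [cf' Df']; split; do ?by move=> x [/cf|/cf'].
  by [].
move=> v; have [dv Dv] := Df v; have [dv' Dv'] := Df' v; split.
  by move=> x [/dv|/dv'].
exact: IH.
Qed.

(** On an open set, equality on the set is equality near each of its points, which transports limits
    and derivatives. *)
Lemma eq_Ck_on (R : realType) (V W : normedModType R) k (U : set V)
    (f g : V -> W) :
  open U -> (forall x, U x -> f x = g x) -> Ck_on k U f -> Ck_on k U g.
Proof.
move=> oU; elim: k f g => [|k IH] f g fg /= [cf Df];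
  (have nfg x : U x -> \near x, f x = g x by
     move=> Ux; near=> y; apply: fg; near: y; exact: open_nbhs_nbhs);
  (have cg x : U x -> {for x, continuous g} by
     move=> Ux; rewrite /prop_for /continuous_at -fg//;
     apply: cvg_trans (cf _ Ux); apply: near_eq_cvg; exact: nfg); split=> //.
move=> v; have [dv Dv] := Df v; split.
  by move=> x Ux; apply: near_eq_derivable (dv _ Ux); exact: nfg.
by apply: IH Dv => x Ux; apply: near_eq_derive; exact: nfg.
Unshelve. all: by end_near. Qed.

Lemma Ck_onW (R : realType) (V W : normedModType R) k (U : set V)
    (f : V -> W) : Ck_on k.+1 U f -> Ck_on k U f.
Proof.
elim: k f => [|k IH] f [cf Df]; split=> // v.
have [dv Dv] := Df v; split=> //; exact: IH.
Qed.

Lemma Ck_on_continuous (R : realType) (V W : normedModType R) k (U : set V)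
    (f : V -> W) : Ck_on k U f -> forall x, U x -> {for x, continuous f}.
Proof. by case: k => [|k] []. Qed.

(** The form used in all inductions below: ['D_v f] is known by a formula only on [U], and that
    formula is shown to be of class C^k. *)
Lemma Ck_onS (R : realType) (V W : normedModType R) k (U : set V)
    (f : V -> W) (df : V -> V -> W) : open U ->
  (forall x, U x -> {for x, continuous f}) ->
  (forall v x, U x -> is_derive x v f (df v x)) ->
  (forall v, Ck_on k U (df v)) -> Ck_on k.+1 U f.
Proof.
move=> oU cf Df Cdf; split=> // v; split=> [x Ux|].
  by have [] := Df v x Ux.
by apply: eq_Ck_on (Cdf v) => // x Ux; have [_ ->] := Df v x Ux.
Qed.

Lemma Ck_on_is_derive (R : realType) (V W : normedModType R) k (U : set V)
    (f : V -> W) v x : Ck_on k.+1 U f -> U x -> is_derive x v f ('D_v f x).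
Proof. by move=> [_ /(_ v) [dv _]] Ux; apply/derivableP/dv. Qed.

Lemma Ck_on_derive (R : realType) (V W : normedModType R) k (U : set V)
    (f : V -> W) v : Ck_on k.+1 U f -> Ck_on k U ('D_v f).
Proof. by move=> [_ /(_ v) []]. Qed.

Lemma Ck_on_cst (R : realType) (V W : normedModType R) k (U : set V) (a : W) :
  open U -> Ck_on k U (fun _ : V => a).
Proof.
move=> oU; elim: k a => [|k IH] a; first by split=> // x _; exact: cvg_cst.
by apply: (Ck_onS (df := fun _ _ => 0)) => // x _; exact: cvg_cst.
Qed.

Lemma Ck_onD (R : realType) (V W : normedModType R) k (U : set V)
    (f g : V -> W) : open U ->
  Ck_on k U f -> Ck_on k U g -> Ck_on k U (fun x => f x + g x).
Proof.
move=> oU; elim: k f g => [|k IH] f g Cf Cg;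
  have cfg x : U x -> {for x, continuous (fun x => f x + g x)} by
    move=> Ux; exact: cvgD (Ck_on_continuous Cf Ux) (Ck_on_continuous Cg Ux).
  by [].
apply: (Ck_onS (df := fun v x => 'D_v f x + 'D_v g x)) => //.
  move=> v x Ux; have := Ck_on_is_derive v Cf Ux; have := Ck_on_is_derive v Cg Ux.
  move=> ? ?; exact: is_deriveD.
by move=> v; apply: IH; exact: Ck_on_derive.
Qed.

Lemma Ck_onM (R : realType) (V : normedModType R) k (U : set V)
    (f g : V -> R^o) : open U ->
  Ck_on k U f -> Ck_on k U g -> Ck_on k U (fun x => f x * g x : R^o).
Proof.
move=> oU; elim: k f g => [|k IH] f g Cf Cg;
  have cfg x : U x -> {for x, continuous (fun x => f x * g x : R^o)} by
    move=> Ux; exact: cvgM (Ck_on_continuous Cf Ux) (Ck_on_continuous Cg Ux).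
  by [].
apply: (Ck_onS (df := fun v x => f x * 'D_v g x + g x * 'D_v f x)) => //.
  move=> v x Ux; have := Ck_on_is_derive v Cf Ux; have := Ck_on_is_derive v Cg Ux.
  move=> ? ?; exact: is_deriveM.
move=> v; apply: Ck_onD => //; apply: IH => //;
  do ?[exact: Ck_onW | exact: Ck_on_derive].
Qed.

(** The derivative -f^-2 f' is written with [(f x)^-1] as a factor, so that the induction hypothesis
    applies to it. *)
Lemma Ck_onV (R : realType) (V : normedModType R) k (U : set V)
    (f : V -> R^o) : open U -> (forall x, U x -> f x != 0) ->
  Ck_on k U f -> Ck_on k U (fun x => (f x)^-1 : R^o).
Proof.
move=> oU f0; elim: k f f0 => [|k IH] f f0 Cf;
  have cf x : U x -> {for x, continuous (fun x => (f x)^-1 : R^o)} by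
    move=> Ux; exact: cvgV (f0 _ Ux) (Ck_on_continuous Cf Ux).
  by [].
apply: (Ck_onS (df := fun v x =>
    (-1 : R) * ((f x)^-1 * (f x)^-1 * 'D_v f x))) => //.
  move=> v x Ux; have [df _] := Ck_on_is_derive v Cf Ux.
  split; first by apply: (derivableV (f0 _ Ux)).
  by rewrite (deriveV (f0 _ Ux) df) expr2 invfM mulN1r scaleNr.
move=> v; apply: Ck_onM => //; first exact: Ck_on_cst.
apply: Ck_onM => //; last exact: Ck_on_derive.
by apply: Ck_onM => //; apply: IH => //; exact: Ck_onW.
Qed.

Lemma Ck_on_sum (R : realType) (V W : normedModType R) k (U : set V) (I : Type)
    (s : seq I) (f : I -> V -> W) : open U ->
  (forall i, Ck_on k U (f i)) -> Ck_on k U (fun x => \sum_(i <- s) f i x).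
Proof.
move=> oU Cf; elim: s => [|i s IH].
  apply: (@eq_Ck_on _ _ _ _ _ (fun=> 0)) => //; last exact: Ck_on_cst.
  by move=> x _; rewrite big_nil.
apply: (@eq_Ck_on _ _ _ _ _ (fun x => f i x + \sum_(j <- s) f j x)) => //.
  by move=> x _; rewrite big_cons.
exact: Ck_onD.
Qed.

Lemma Ck_on_prod (R : realType) (V : normedModType R) k (U : set V) (I : Type)
    (s : seq I) (f : I -> V -> R^o) : open U ->
  (forall i, Ck_on k U (f i)) ->
  Ck_on k U (fun x => \prod_(i <- s) f i x : R^o).
Proof.
move=> oU Cf; elim: s => [|i s IH].
  apply: (@eq_Ck_on _ _ _ _ _ (fun=> 1 : R^o)) => //; last exact: Ck_on_cst.
  by move=> x _; rewrite big_nil.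
apply: (@eq_Ck_on _ _ _ _ _ (fun x => f i x * \prod_(j <- s) f j x)) => //.
  by move=> x _; rewrite big_cons.
exact: Ck_onM.
Qed.

Lemma continuous_rVP (R : realType) (T : topologicalType) m
    (F : T -> 'rV[R]_m) x :
  {for x, continuous F} <-> forall j, {for x, continuous (fun y => F y 0 j : R^o)}.
Proof.
split=> [cF j|cF].
  apply: (@continuous_comp _ _ _ F (fun M : 'rV[R]_m => M 0 j : R^o)) => //.
  exact: coord_continuous.
move=> A [P FP sPA]; rewrite /= nbhs_filterE; near=> y; apply: sPA => i j.
rewrite ord1; move: j; near: y; apply: filter_forall => j; apply: cF.
exact: FP.
Unshelve. all: by end_near. Qed.

Lemma Ck_on_rVP (R : realType) (V : normedModType R) k (U : set V) m
    (F : V -> 'rV[R]_m) : open U ->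
  Ck_on k U F <-> forall j, Ck_on k U (fun x => F x 0 j : R^o).
Proof.
move=> oU; elim: k F => [|k IH] F; split=> CF.
- move=> j; split=> // x Ux.
  exact: (continuous_rVP F x).1 (Ck_on_continuous CF Ux) j.
- split=> // x Ux; apply/continuous_rVP => j.
  exact: Ck_on_continuous (CF j) x Ux.
- move=> j; apply: (Ck_onS (df := fun v x => 'D_v F x 0 j)) => //.
  + by move=> x Ux; exact: (continuous_rVP F x).1 (Ck_on_continuous CF Ux) j.
  + move=> v x Ux; have [dF _] := Ck_on_is_derive v CF Ux; split.
      exact: (derivable_mxP _ _ _).1 dF 0 j.
    by rewrite derive_mx// mxE.
  + by move=> v; move: j; apply/IH; exact: Ck_on_derive.
- apply: (Ck_onS (df := fun v x => \row_j 'D_v (fun x => F x 0 j : R^o) x)) => //.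
  + move=> x Ux; apply/continuous_rVP => j.
    exact: Ck_on_continuous (CF j) x Ux.
  + move=> v x Ux; have dF : derivable F x v.
      apply/derivable_mxP => i j; rewrite ord1.
      by have [] := Ck_on_is_derive v (CF j) Ux.
    by split=> //; rewrite derive_mx//; apply/rowP => j; rewrite !mxE.
  + move=> v; apply/IH => j.
    apply: (@eq_Ck_on _ _ _ _ _ ('D_v (fun x => F x 0 j : R^o))) => //.
      by move=> x _; rewrite mxE.
    exact: Ck_on_derive.
Qed.

(** * Directional derivatives along lines, differentiability and the chain rule *)

Lemma derivable_affine (R : realType) (V V' W : normedModType R) (f : V -> W)
    (A L : V' -> V) y u : (forall h, A (h *: u + y) = h *: L u + A y) ->
  derivable f (A y) (L u) -> derivable (f \o A) y u.
Proof.
move=> AE; rewrite /derivable; set p := (X in cvg (X @ _) -> _).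
set q := (X in _ -> cvg (X @ _)); suff -> : p = q by [].
by apply/funext => h; rewrite /p /q /= AE.
Qed.

Lemma derive_affine (R : realType) (V V' W : normedModType R) (f : V -> W)
    (A L : V' -> V) y u : (forall h, A (h *: u + y) = h *: L u + A y) ->
  'D_u (f \o A) y = 'D_(L u) f (A y).
Proof.
move=> AE; rewrite /derive; set p := (X in lim (X @ _) = _).
set q := (X in _ = lim (X @ _)); suff -> : p = q by [].
by apply/funext => h; rewrite /p /q /= AE.
Qed.

(* Along an affine map, directional derivatives are directional derivatives, so
   neither differentiability nor openness of U is involved. *)
Lemma Ck_on_affine (R : realType) (V V' W : normedModType R) k (U : set V)
    (f : V -> W) (A L : V' -> V) :
  continuous A -> (forall h u y, A (h *: u + y) = h *: L u + A y) ->
  Ck_on k U f -> Ck_on k (A @^-1` U) (f \o A).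
Proof.
move=> cA AE; elim: k f => [|k IH] f [cf Df]; split=> //;
  do ?by move=> x Ux; apply: continuous_comp; [exact: cA|exact: cf].
move=> v; have [dv Dv] := Df (L v); split=> [x Ux|].
  exact: derivable_affine (dv _ Ux).
have -> : 'D_v (f \o A) = 'D_(L v) f \o A.
  by apply/funext => x; exact: derive_affine.
exact: IH.
Qed.

(** On the line through [x] directed by [v], [f] is a function of one real variable; there
    derivability gives a differential, which is linear. *)
Lemma derive_scale (R : realType) (V W : normedModType R) (f : V -> W) x v a :
  derivable f x v -> 'D_(a *: v) f x = a *: 'D_v f x.
Proof.
pose g (h : R) := f (h *: v + x) => df.
have dg : differentiable g 0.
  by apply/derivable1_diffP; exact: (derivable1P _ _ _).1 df.
have gE w : 'D_w g 0 = 'D_(w *: v) f x.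
  rewrite /g (@derive_affine _ _ _ _ f (fun h : R => h *: v + x)
    (fun h : R => h *: v)) ?scale0r ?add0r// => h.
  by rewrite addr0 scalerA.
rewrite -gE; have := gE 1; rewrite scale1r => <-.
by rewrite !deriveE// -[X in 'd _ _ X = _]mulr1 [LHS]linearZ.
Qed.

Lemma MVT_line (R : realType) (V : normedModType R) (f : V -> R^o) x v :
  (forall s : R, 0 <= s <= 1 -> derivable f (s *: v + x) v) ->
  exists2 s : R, 0 <= s <= 1 & f (v + x) - f x = 'D_v f (s *: v + x).
Proof.
move=> df; pose g (s : R) : R := f (s *: v + x).
have gE (s h : R) : (h *: (1 : R) + s) *: v + x = h *: v + (s *: v + x).
  by rewrite scalerDl -scalerA scale1r addrA.
have dg (s : R) : 0 <= s <= 1 -> is_derive s 1 g ('D_v f (s *: v + x)).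
  move=> s01; split; first exact: (derivable_affine (gE s) (df s s01)).
  exact: (derive_affine f (gE s)).
have cg : {within `[0 : R, 1], continuous g}.
  apply: derivable_within_continuous => s; rewrite in_itv/= => /dg [].
  by [].
have [|s] := MVT_segment ler01 _ cg (df := fun s => 'D_v f (s *: v + x)).
  by move=> s; rewrite in_itv/= => /andP[/ltW s0 /ltW s1]; apply: dg; rewrite s0.
rewrite in_itv/= subr0 mulr1 /g scale1r scale0r add0r => s01 E.
by exists s.
Qed.

(* Split the increment along h (v + w) into one along h v from x and one along
   h w from x + h v; the latter is evaluated by the mean value theorem, and the
   continuity of 'D_w f brings it back to x. *)
Lemma deriveDr (R : realType) (V : normedModType R) (U : set V) (f : V -> R^o)
    x v w : open U -> U x ->
  (forall y u, U y -> derivable f y u) -> {for x, continuous ('D_w f)} ->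
  'D_(v + w) f x = 'D_v f x + 'D_w f x.
Proof.
move=> oU Ux df cD; apply: cvg_lim => //.
pose q1 (h : R) := h^-1 *: (f (h *: w + (h *: v + x)) - f (h *: v + x)).
pose q2 (h : R) := h^-1 *: (f (h *: v + x) - f x).
rewrite [X in X @ _](_ : _ = q2 \+ q1); last first.
  apply/funext => h; rewrite /q1 /q2 /= -scalerDr; congr (_ *: _).
  rewrite [RHS]addrC [RHS]addrA subrK; congr (f _ - _).
  by rewrite scalerDr -addrA addrCA.
apply: cvgD; first exact: df.
apply/cvgrPdist_le => e e0.
have /nbhs_ballP[d /= d0 dU] :
    nbhs x (U `&` [set y | `|'D_w f x - 'D_w f y| <= e]).
  apply: filterI; first exact: open_nbhs_nbhs.
  by move/cvgrPdist_le: cD => /(_ e e0).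
near=> h.
have hlt (s : R) : 0 <= s <= 1 -> ball x d (s *: (h *: w) + (h *: v + x)).
  move=> /andP[s0 s1].
  rewrite -ball_normE /= addrA opprD addrCA subrr addr0 normrN.
  apply: le_lt_trans (_ : `|h| * (`|v| + `|w|) < _).
    rewrite (le_trans (ler_normD _ _))// !normrZ mulrDr addrC lerD2l.
    by rewrite ger0_norm// ler_piMl// mulr_ge0.
  (* Adding 1 keeps the divisor positive when [v] and [w] both vanish. *)
  apply: (@le_lt_trans _ _ (`|h| * (`|v| + `|w| + 1))).
    by rewrite ler_wpM2l// lerDl.
  rewrite -ltr_pdivlMr ?ltr_wpDl ?addr_ge0//.
  near: h; apply: dnbhs0_lt; apply: divr_gt0 => //.
  by rewrite ltr_wpDl ?addr_ge0.
have [|s s01 E] := @MVT_line _ _ f (h *: v + x) (h *: w).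
  by move=> s s01; apply: df; apply: (dU _ _).1; exact: hlt.
rewrite /q1 E derive_scale; last by apply: df; apply: (dU _ _).1; exact: hlt.
rewrite scalerA mulVf ?scale1r; last by near: h; exact: nbhs_dnbhs_neq.
exact: (dU _ (hlt _ s01)).2.
Unshelve. all: by end_near. Qed.

Lemma derive_sumr (R : realType) (V : normedModType R) (U : set V)
    (f : V -> R^o) x (I : Type) (s : seq I) (c : I -> R) (v : I -> V) :
  Ck_on 1 U f -> open U -> U x ->
  'D_(\sum_(i <- s) c i *: v i) f x = \sum_(i <- s) c i * 'D_(v i) f x.
Proof.
move=> Cf oU Ux; have df y u : U y -> derivable f y u.
  by move=> Uy; have [] := Ck_on_is_derive u Cf Uy.
have cD u : {for x, continuous ('D_u f)}.
  exact: (Ck_on_continuous (Ck_on_derive u Cf)).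
elim: s => [|i s IH]; first by rewrite !big_nil derive0.
by rewrite !big_cons (deriveDr _ oU)// IH derive_scale//; exact: df.
Qed.

Lemma derive_coord (R : realType) m (U : set 'rV[R]_m) (f : 'rV[R]_m -> R^o)
    x v : Ck_on 1 U f -> open U -> U x ->
  'D_v f x = \sum_i v 0 i * 'D_(delta_mx 0 i) f x.
Proof.
move=> Cf oU Ux; rewrite {1}[v]row_sum_delta.
exact: (derive_sumr _ _ _ Cf oU Ux).
Qed.

Lemma coord_le_norm (R : realType) m (v : 'rV[R]_m) i : `|v 0 i| <= `|v|.
Proof.
by rewrite [leRHS]/Num.Def.normr /= mx_normrE (le_bigmax _ _ (0, i)).
Qed.

(** [differentiable] refers to the canonical differential ['d f x]; the expansion with remainder
    o(h) identifies it with [df] by uniqueness. *)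
Lemma differentiable_of_linear (R : realType) (V W : normedModType R)
    (f : V -> W) x (df : {linear V -> W}) : continuous df ->
  (forall e : R, 0 < e ->
     \forall h \near 0, `|f (h + x) - (f x + df h)| <= e * `|h|) ->
  differentiable f x.
Proof.
move=> cdf fE.
have littleo_df : f \o shift x = cst (f x) + df +o_ 0 id.
  by apply/eqaddoP => e e0; exact: fE.
by apply/diff_locallyP; rewrite (diff_unique cdf littleo_df).
Qed.

(* The increment along h is 'D_h f at an intermediate point, where 'D_h f is
   linear in h with coefficients close to those at x. *)
Lemma C1_differentiable (R : realType) m (U : set 'rV[R]_m)
    (f : 'rV[R]_m -> R^o) x : Ck_on 1 U f -> open U -> U x ->
  differentiable f x.
Proof.
move=> Cf oU Ux; pose df (v : 'rV[R]_m) : R^o := 'D_v f x.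
have dfE v : df v = \sum_i v 0 i * 'D_(delta_mx 0 i) f x.
  exact: (derive_coord v Cf oU Ux).
have df_lin : linear df.
  move=> a u v; rewrite !dfE scaler_sumr -big_split; apply: eq_bigr => i _ /=.
  by rewrite !mxE mulrDl -mulrA.
pose dfM := GRing.isLinear.Build _ _ _ _ _ df_lin.
pose dfL : {linear 'rV[R]_m -> R^o} := HB.pack df dfM.
have df_cont : continuous dfL.
  have -> : dfL = (fun v => \sum_i v 0 i * 'D_(delta_mx 0 i) f x) :> (_ -> _).
    exact/funext.
  move=> v; apply: (@cvg_big _ _ _ _ _ _ _ (nbhs v)) => [|i _].
    exact: add_continuous.
  by apply: (@cvgM _ _ (nbhs v)); [exact: coord_continuous | exact: cvg_cst].
apply: (differentiable_of_linear df_cont) => e e0.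
(* Each of the [m] coordinates contributes an error of at most [d] times the norm of [h]; [m.+1]
   makes the quotient meaningful for [m] = 0. *)
pose d := e / m.+1%:R.
have d0 : 0 < d by rewrite divr_gt0.
have nD : \forall y \near x, forall i : 'I_m,
    `|'D_(delta_mx 0 i) f x - 'D_(delta_mx 0 i) f y| <= d.
  apply: (@filter_forall _ _ _ (nbhs x)) => i.
  have := Ck_on_continuous (Ck_on_derive (delta_mx 0 i) Cf) Ux.
  by move/cvgrPdist_le => /(_ d d0).
have /nbhs_ballP[r /= r0 rU] : nbhs x (U `&` [set y | forall i : 'I_m,
    `|'D_(delta_mx 0 i) f x - 'D_(delta_mx 0 i) f y| <= d]).
  by apply: filterI => //; exact: open_nbhs_nbhs.
near=> h.
have hr (s : R) : 0 <= s <= 1 -> ball x r (s *: h + x).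
  move=> /andP[s0 s1]; rewrite -ball_normE /= opprD addrCA subrr addr0 normrN.
  rewrite normrZ ger0_norm//; apply: (@le_lt_trans _ _ `|h|).
    by rewrite ler_piMl.
  by near: h; exact: (@nbhs0_lt _ 'rV[R]_m).
have Uh (s : R) : 0 <= s <= 1 -> U (s *: h + x) by move=> /hr /rU [].
have [|s s01 E] := @MVT_line _ _ f x h.
  by move=> s /Uh /(Ck_on_is_derive h Cf) [].
have := E; rewrite (derive_coord _ Cf oU (Uh _ s01)) => {}E.
rewrite opprD addrA E dfE -sumrB (le_trans (ler_norm_sum _ _ _))//.
apply: (@le_trans _ _ (\sum_(i < m) d * `|h|)).
  apply: ler_sum => i _; rewrite -mulrBr normrM mulrC ler_pM//; last first.
    exact: coord_le_norm.
  by rewrite distrC; apply: (rU _ (hr _ s01)).2.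
rewrite sumr_const card_ord -mulr_natr mulrAC ler_wpM2r//.
by rewrite /d mulrAC ler_pdivrMr// ler_pM2l// ler_nat.
Unshelve. all: by end_near. Qed.

(** [F] is only assumed derivable along [v], so the chain rule for differentials is applied to [g]
    and the curve h |-> F (h v + x), which is differentiable at 0. *)
Lemma is_derive_comp (R : realType) (V : normedModType R) m (U : set 'rV[R]_m)
    (F : V -> 'rV[R]_m) (g : 'rV[R]_m -> R^o) x v dF :
  Ck_on 1 U g -> open U -> U (F x) -> is_derive x v F dF ->
  is_derive x v (g \o F) ('D_dF g (F x)).
Proof.
move=> Cg oU UFx [dFx <-].
have dg := C1_differentiable Cg oU UFx.
pose L (h : R) := F (h *: v + x).
have dL : derivable L 0 1 := (derivable1P _ _ _).1 dFx.
have dL' := (derivable1_diffP _ _).1 dL.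
have L0 : L 0 = F x by rewrite /L scale0r add0r.
have dgL : differentiable (g \o L) 0.
  by apply: differentiable_comp => //; rewrite L0.
have lineE (W : normedModType R) (f : V -> W) :
    'D_1 (fun h : R => f (h *: v + x)) 0 = 'D_v f x.
  have AE (h : R) : (h *: (1 : R) + 0) *: v + x = h *: v + (0 *: v + x).
    by rewrite addr0 scale0r add0r -scalerA scale1r.
  by rewrite (derive_affine f AE) scale0r add0r.
split; first by apply/derivable1P/derivable1_diffP.
rewrite -[LHS](lineE _ (g \o F)) -(lineE _ F) !deriveE//.
by rewrite (diff_comp dL') L0.
Qed.

(** The chain rule expresses a derivative of the composite by derivatives of [F] and composites of
    partial derivatives of [g] with [F], to which the induction hypothesis applies. *)
Lemma Ck_on_comp (R : realType) (V : normedModType R) m k (U : set V)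
    (U' : set 'rV[R]_m) (F : V -> 'rV[R]_m) (g : 'rV[R]_m -> R^o) :
  open U -> open U' -> (forall x, U x -> U' (F x)) ->
  Ck_on k U F -> Ck_on k U' g -> Ck_on k U (g \o F).
Proof.
move=> oU oU' FU; elim: k F g FU => [|k IH] F g FU CF Cg;
  have cgF x : U x -> {for x, continuous (g \o F)} by
    move=> Ux; apply: continuous_comp; [exact: Ck_on_continuous CF x Ux |
      apply: (Ck_on_continuous Cg); exact: FU].
  by [].
have Cg1 : Ck_on 1 U' g by elim: {IH CF} k Cg => // k IH /Ck_onW.
apply: (Ck_onS (df := fun v x =>
    \sum_(i < m) 'D_v F x 0 i * 'D_(delta_mx 0 i) g (F x))) => //.
  move=> v x Ux; rewrite -(derive_coord _ Cg1 oU' (FU _ Ux)).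
  apply: (is_derive_comp Cg1 oU'); first exact: FU.
  exact: Ck_on_is_derive CF Ux.
move=> v; apply: Ck_on_sum => // i; apply: Ck_onM => //.
  by move: i; apply/Ck_on_rVP => //; exact: Ck_on_derive.
apply: (IH F ('D_(delta_mx 0 i) g)) => //; first exact: Ck_onW.
exact: Ck_on_derive.
Qed.

Lemma Ck_on_comp_rV (R : realType) (V : normedModType R) m p k (U : set V)
    (U' : set 'rV[R]_m) (F : V -> 'rV[R]_m) (g : 'rV[R]_m -> 'rV[R]_p) :
  open U -> open U' -> (forall x, U x -> U' (F x)) ->
  Ck_on k U F -> Ck_on k U' g -> Ck_on k U (g \o F).
Proof.
move=> oU oU' FU CF Cg; apply/Ck_on_rVP => // j.
apply: (Ck_on_comp (g := fun y => g y 0 j) oU oU') => //.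
exact: (Ck_on_rVP _ _ oU').1 Cg j.
Qed.

Lemma is_derive_comp_rV (R : realType) (V : normedModType R) m p
    (U : set 'rV[R]_m) (F : V -> 'rV[R]_m) (g : 'rV[R]_m -> 'rV[R]_p) x v dF :
  Ck_on 1 U g -> open U -> U (F x) -> is_derive x v F dF ->
  is_derive x v (g \o F) ('D_dF g (F x)).
Proof.
move=> Cg oU UFx DF.
have Dj j : is_derive x v (fun y => g (F y) 0 j : R^o)
    ('D_dF (fun y => g y 0 j : R^o) (F x)).
  apply: (is_derive_comp (g := fun y => g y 0 j) _ oU UFx DF).
  exact: (Ck_on_rVP _ _ oU).1 Cg j.
have dgF : derivable (g \o F) x v.
  by apply/derivable_mxP => i j; rewrite ord1; have [] := Dj j.
split => //; rewrite derive_mx// derive_mx.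
  by apply/rowP => j; rewrite !mxE; have [_ <-] := Dj j.
by have [] := Ck_on_is_derive dF Cg UFx.
Qed.

Lemma derive_linear_rV (R : realType) m p (U : set 'rV[R]_m)
    (g : 'rV[R]_m -> 'rV[R]_p) x v : Ck_on 1 U g -> open U -> U x ->
  'D_v g x = v *m (\matrix_(i, j) 'D_(delta_mx 0 i) g x 0 j).
Proof.
move=> Cg oU Ux; have Cgj j := (Ck_on_rVP 1 g oU).1 Cg j.
have dg w : derivable g x w by have [] := Ck_on_is_derive w Cg Ux.
rewrite derive_mx//; apply/rowP => j; rewrite !mxE (derive_coord _ (Cgj j) oU)//.
by apply: eq_bigr => i _; rewrite [in RHS]mxE derive_mx// mxE.
Qed.

(** * Bump functions on R^n *)

(* The derivative of x^-k exp(-1/x) is a combination of two functions of the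
   same family, so smoothness of the whole family follows by induction. *)
Definition flat (R : realType) (k : nat) (x : R) : R :=
  if 0 < x then x^-1 ^+ k * expR (- x^-1) else 0.

Lemma flat_le0 (R : realType) k (x : R) : x <= 0 -> flat k x = 0.
Proof. by rewrite /flat ltNge => ->. Qed.

Lemma flat0_gt0 (R : realType) (x : R) : 0 < x -> 0 < flat 0 x.
Proof. by move=> x0; rewrite /flat x0 expr0 mul1r expR_gt0. Qed.

Lemma flat0_ge0 (R : realType) (x : R) : 0 <= flat 0 x.
Proof. by have [/flat_le0->//|/flat0_gt0/ltW] := leP x 0. Qed.

(** With y = 1/x > 0, the exponential series gives y^(k+1) / (k+1)! <= e^y, that is y^k e^(-y) <=
    (k+1)! x. This linear bound gives the limit 0 at the origin. *)
Lemma norm_flat (R : realType) k (x : R) :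
  `|flat k x| <= (k.+1)`!%:R * `|x|.
Proof.
have [x0|x0] := leP x 0; first by rewrite flat_le0// normr0 mulr_ge0.
have y0 : 0 < x^-1 by rewrite invr_gt0.
rewrite /flat x0 ger0_norm; last by rewrite mulr_ge0 ?expR_ge0 ?exprn_ge0// ltW.
rewrite gtr0_norm// expRN ler_pdivrMr ?expR_gt0// -(ler_pM2r y0) -exprSr.
rewrite mulrAC mulfK ?gt_eqF// mulrC -ler_pdivrMr ?ltr0n ?fact_gt0//.
by apply: le_trans (expR_ge1Dxn k (ltW y0)); rewrite lerDr.
Qed.

Lemma is_derive1_dir (R : realType) (W : normedModType R) (f : R^o -> W)
    (x v : R) df : is_derive x 1 f df -> is_derive (x : R^o) (v : R^o) f (v *: df).
Proof.
move=> [dfx <-]; have dF := (derivable1_diffP _ _).1 dfx.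
split; first exact: diff_derivable.
by rewrite -[X in 'D_X _ _](mulr1 v); exact: derive_scale.
Qed.

Lemma is_derive_flat (R : realType) k (x : R) :
  is_derive x 1 (flat k) (flat k.+2 x - k%:R * flat k.+1 x).
Proof.
have [x0|x0|->] := ltgtP x 0.
- rewrite !flat_le0 ?ltW// mulr0 subr0.
  apply: (@near_eq_is_derive _ _ _ (cst (0 : R))).
  near=> y; rewrite flat_le0//; near: y; apply: filterS (lt_nbhsl x0).
  by move=> y /ltW.
- have nE : \near x, (fun y => y^-1 ^+ k * expR (- y^-1)) x = flat k x.
    near=> y; rewrite /flat (_ : 0 < y)//; near: y; exact: lt_nbhsr.
  suff D : is_derive x 1 (fun y : R => y^-1 ^+ k * expR (- y^-1))
      (flat k.+2 x - k%:R * flat k.+1 x) by exact: near_eq_is_derive nE D.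
  rewrite /flat x0; have xn0 : x != 0 by rewrite gt_eqF.
  have dV : is_derive x 1 (fun y : R => y^-1) (- x^-1 ^+ 2).
    split; first by apply: derivableV.
    by rewrite deriveV// derive_id exprVn; exact: mulr1.
  have dE := is_derive1_comp (is_derive_expR _) (is_deriveN dV).
  have dX := is_deriveX k dV.
  have fE : (fun y : R => y^-1 ^+ k * expR (- y^-1)) =
      (fun y : R => y^-1) ^+ k * (expR \o (- (fun y : R => y^-1))).
    by rewrite exprfctE.
  rewrite fE; apply: is_derive_eq (is_deriveM dX dE) _.
  rewrite exprfctE /= /GRing.scale /= opprK.
  (* The derivative of a power has the exponent [k.-1], which is truncated at [k] = 0. *)
  case: k {nE dX fE} => [|k].
    by rewrite expr0 !mul0r mulr0 subr0 addr0 mul1r mulrC.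
  rewrite -pred_Sn; set y := x^-1; set e := expR _.
  by rewrite !exprS; ring.
- rewrite !flat_le0// mulr0 subr0.
  have cvg0 : h^-1 *: (flat k (h *: 1 + 0) - flat k 0) @[h --> 0^'] --> (0 : R).
    (* The difference quotient at 0 of a member of the family is the next member, which tends to
       0. *)
    rewrite [X in X @ _](_ : _ = flat k.+1); last first.
      apply/funext => h.
      rewrite (flat_le0 k (lexx 0)) subr0 addr0 /GRing.scale /= mulr1.
      have [h0|h0] := leP h 0; first by rewrite !flat_le0// mulr0.
      by rewrite /flat h0 mulrA -exprS.
    apply/cvgr0Pnorm_le => e e0; near=> h.
    rewrite (le_trans (norm_flat _ _))// mulrC -ler_pdivlMr ?ltr0n ?fact_gt0//.
    apply: ltW; near: h; apply: dnbhs0_lt; apply: divr_gt0 => //.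
    by rewrite ltr0n fact_gt0.
  split; first by apply/cvg_ex; exists 0.
  exact: cvg_lim cvg0.
Unshelve. all: by end_near. Qed.

Lemma Ck_on_flat (R : realType) n k :
  Ck_on n [set: R^o] (flat k : R^o -> R^o).
Proof.
elim: n k => [|n IH] k;
  have cf (x : R^o) : [set: R^o] x -> {for x, continuous (flat k : R^o -> R^o)} by
    move=> _; apply: differentiable_continuous;
    have [d _] := is_derive_flat k x; exact: (derivable1_diffP _ _).1 d.
  by [].
apply: (@Ck_onS _ _ _ _ _ _ (fun v x : R^o =>
  v * (flat k.+2 x + (- k%:R) * flat k.+1 x) : R^o)) => //.
- exact: openT.
- by move=> v x _; rewrite mulNr; apply: is_derive1_dir; exact: is_derive_flat.
- move=> v; apply: Ck_onM; [exact: openT|apply: Ck_on_cst; exact: openT|].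
  apply: Ck_onD; [exact: openT|exact: IH|].
  by apply: Ck_onM; [exact: openT|apply: Ck_on_cst; exact: openT|exact: IH].
Qed.

Definition ramp (R : realType) (x : R) : R :=
  flat 0 x / (flat 0 x + flat 0 (1 - x)).

Lemma ramp_le0 (R : realType) (x : R) : x <= 0 -> ramp x = 0.
Proof. by move=> x0; rewrite /ramp flat_le0// mul0r. Qed.

(** [x] and [1 - x] cannot both be nonpositive. *)
Lemma ramp_den_gt0 (R : realType) (x : R) : 0 < flat 0 x + flat 0 (1 - x).
Proof.
have [x0|x0] := ltP 0 x; first by rewrite ltr_wpDr ?flat0_ge0 ?flat0_gt0.
by rewrite ltr_wpDl ?flat0_ge0// flat0_gt0// subr_gt0 (le_lt_trans x0).
Qed.

Lemma ramp_ge1 (R : realType) (x : R) : 1 <= x -> ramp x = 1.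
Proof.
move=> x1; have := ramp_den_gt0 x.
rewrite /ramp (@flat_le0 _ 0 (1 - x)) ?subr_le0//.
by rewrite addr0 => f0; rewrite divff// gt_eqF.
Qed.

Lemma Ck_on_ramp (R : realType) n : Ck_on n [set: R^o] (@ramp R : R^o -> R^o).
Proof.
have oT : open [set: R^o] by exact: openT.
apply: Ck_onM => //; first exact: Ck_on_flat.
apply: Ck_onV => //; first by move=> x _; rewrite gt_eqF// ramp_den_gt0.
apply: Ck_onD => //; first exact: Ck_on_flat.
apply: (Ck_on_affine (U := setT) (A := fun x : R^o => 1 - x : R^o)
  (L := fun x => - x)).
- by move=> x; apply: cvgB; [exact: cvg_cst|exact: cvg_id].
- by move=> h u y; rewrite opprD scalerN addrCA.
- exact: Ck_on_flat.
Qed.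

(** With u = (x_i - a_i)/r, both factors are 1 when |u| <= 1 and one of them is 0 when |u| >= 2. Two
    ramps replace a ramp of 2 - |u|, so that only affine functions are composed with [ramp]. *)
Definition box_bump (R : realType) m (a : 'rV[R]_m) (r : R)
    (x : 'rV[R]_m) : R :=
  \prod_i (ramp (2 + - r^-1 * (x 0 i - a 0 i)) *
           ramp (2 + r^-1 * (x 0 i - a 0 i))).

Lemma box_bump1 (R : realType) m (a : 'rV[R]_m) (r : R) (x : 'rV[R]_m) : 0 < r ->
  (forall i, `|x 0 i - a 0 i| <= r) -> box_bump a r x = 1.
Proof.
move=> r0 xa; rewrite /box_bump big1// => i _.
have : `|r^-1 * (x 0 i - a 0 i)| <= 1.
  by rewrite normrM gtr0_norm ?invr_gt0// mulrC ler_pdivrMr// mul1r.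
rewrite ler_norml => /andP[lb ub].
by rewrite !ramp_ge1 ?mulr1// ?mulNr; lra.
Qed.

Lemma box_bump0 (R : realType) m (a : 'rV[R]_m) (r : R) (x : 'rV[R]_m) : 0 < r ->
  box_bump a r x != 0 -> forall i, `|x 0 i - a 0 i| <= 2 * r.
Proof.
move=> r0 /prodf_neq0 b0 i; rewrite leNgt; apply/negP => xa.
have : 2 < `|r^-1 * (x 0 i - a 0 i)|.
  by rewrite normrM gtr0_norm ?invr_gt0// mulrC ltr_pdivlMr.
have /(_ isT) := b0 i; rewrite mulf_eq0 negb_or => /andP[b1 b2].
rewrite real_ltr_normr ?num_real// => /orP[] h.
  by move: b1; rewrite ramp_le0 ?eqxx// mulNr; lra.
by move: b2; rewrite ramp_le0 ?eqxx//; lra.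
Qed.

Lemma Ck_on_box_bump (R : realType) m (a : 'rV[R]_m) (r : R) k :
  Ck_on k [set: 'rV[R]_m] (box_bump a r : 'rV[R]_m -> R^o).
Proof.
have oT : open [set: 'rV[R]_m] by exact: openT.
have Cr (c : R) i : Ck_on k [set: 'rV[R]_m]
    (fun x : 'rV[R]_m => ramp (2 + c * (x 0 i - a 0 i)) : R^o).
  apply: (@Ck_on_affine _ _ _ _ k setT (@ramp R : R^o -> R^o)
    (fun x : 'rV[R]_m => 2 + c * (x 0 i - a 0 i) : R^o)
    (fun x : 'rV[R]_m => c * x 0 i : R^o)).
  - move=> x; apply: (@cvgD _ _ _ (nbhs x)); first exact: cvg_cst.
    apply: (@cvgM _ _ (nbhs x)); first exact: cvg_cst.
    apply: (@cvgB _ _ _ (nbhs x)); last exact: cvg_cst.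
    exact: coord_continuous.
  - move=> h u y; rewrite !mxE /GRing.scale /=; ring.
  - exact: Ck_on_ramp.
by apply: Ck_on_prod => // i; apply: Ck_onM => //; exact: Cr.
Qed.

Lemma compact_box (R : realType) m (a : 'rV[R]_m) (r : R) :
  compact [set x : 'rV[R]_m | forall i, `|x 0 i - a 0 i| <= r].
Proof.
rewrite (_ : mkset _ = [set x : 'rV[R]_m | forall i,
    `[a 0 i - r, a 0 i + r]%classic (x 0 i)]).
  apply: (@rV_compact _ _ (fun i => `[a 0 i - r, a 0 i + r]%classic)) => i.
  exact: segment_compact.
by apply/funext => x /=; apply/propext; split=> xa i; have := xa i;
  rewrite in_itv/= -ler_distlC distrC.
Qed.

Lemma nbhs_box (R : realType) m (a : 'rV[R]_m) (A : set 'rV[R]_m) : nbhs a A ->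
  exists2 r, 0 < r &
    forall x : 'rV[R]_m, (forall i, `|x 0 i - a 0 i| <= r) -> A x.
Proof.
(* Half the radius puts the closed box inside the open ball. *)
move=> /nbhs_ballP[e /= e0 eA]; exists (e / 2); first by rewrite divr_gt0.
move=> x xa; apply: eA; split=> // i j; rewrite ord1 -ball_normE /= distrC.
by rewrite (le_lt_trans (xa j))// ltr_pdivrMr// mulr_natr mulr2n ltrDl.
Qed.

Lemma near_box (R : realType) m (a : 'rV[R]_m) (r : R) : 0 < r ->
  nbhs a [set x | forall i, `|x 0 i - a 0 i| <= r].
Proof.
move=> r0; apply/nbhs_ballP; exists r => //= x [_ xa] i.
by have := xa 0 i; rewrite -ball_normE /= distrC => /ltW.
Qed.

(** * Charts, tangent spaces and vector fields *)

Definition overlap (R : realType) (n : nat) (M : topologicalType)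
  (c d : chart R n M) : set 'rV[R]_n := cmap c @` (cdom c `&` cdom d).

Lemma overlapP (R : realType) (n : nat) (M : topologicalType)
    (c d : chart R n M) x :
  overlap c d x <-> cimg c x /\ cdom d (cinv c x).
Proof.
split=> [[p [cp dp] <-]|[[p cp <-]]]; last by rewrite cmapK// => dp; exists p.
by split; [exists p|rewrite cmapK].
Qed.

Lemma open_cimg (R : realType) (n : nat) (M : topologicalType)
    (c : chart R n M) : open (cimg c).
Proof. exact: cimg_open. Qed.

Lemma open_cimg_preimage (R : realType) (n : nat) (M : topologicalType)
    (c : chart R n M) (A : set M) :
  open A -> open (cimg c `&` cinv c @^-1` A).
Proof.
move=> oA; rewrite openE => x [cx Ax].
apply: filterI; first by apply: open_nbhs_nbhs; split=> //; exact: open_cimg.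
by apply: (cinv_continuous cx); exact: open_nbhs_nbhs.
Qed.

Lemma overlapE (R : realType) (n : nat) (M : topologicalType)
    (c d : chart R n M) : overlap c d = cimg c `&` cinv c @^-1` cdom d.
Proof. by apply/seteqP; split=> x /overlapP. Qed.

Lemma open_overlap (R : realType) (n : nat) (M : topologicalType)
    (c d : chart R n M) : open (overlap c d).
Proof. by rewrite overlapE; exact: open_cimg_preimage (@cdom_open _ _ _ d). Qed.

Lemma cinv_cimg (R : realType) (n : nat) (M : topologicalType)
    (c : chart R n M) x : cimg c x -> cdom c (cinv c x) /\ cmap c (cinv c x) = x.
Proof. by move=> [p cp <-]; rewrite cmapK. Qed.

Lemma transition_cmap (R : realType) (n : nat) (M : topologicalType)
    (c d : chart R n M) p : cdom c p -> transition c d (cmap c p) = cmap d p.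
Proof. by move=> cp; rewrite /transition /= cmapK. Qed.

Lemma smooth_transition (R : realType) (n : nat) (M : manifold R n)
    (c d : chart R n M) : atlas c -> atlas d ->
  smooth_on (overlap c d) (transition c d).
Proof. by move=> Ac Ad; exact: (atlas_compatible Ac Ad).1. Qed.

Lemma overlap_cmap (R : realType) (n : nat) (M : topologicalType)
    (c d : chart R n M) p : cdom c p -> cdom d p -> overlap c d (cmap c p).
Proof. by move=> cp dp; exists p. Qed.

(** The transition from [c] to [d'] factors through [d] on [overlap c d], an open neighbourhood of
    [cmap c p], which suffices for derivatives at that point. *)
Lemma derive_transition_comp (R : realType) (n : nat) (M : manifold R n)
    (p : M) (c d d' : chart R n M) v :
  chart_around p c -> chart_around p d -> chart_around p d' ->
  'D_v (transition c d') (cmap c p) =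
  'D_('D_v (transition c d) (cmap c p)) (transition d d') (cmap d p).
Proof.
move=> [Ac cp] [Ad dp] [Ad' d'p].
have Dcd := Ck_on_is_derive v (smooth_transition Ac Ad 1) (overlap_cmap cp dp).
have oU := @open_overlap _ _ _ d d'.
have Ux : overlap d d' (transition c d (cmap c p)).
  by rewrite transition_cmap//; exact: overlap_cmap.
have [_ E] := is_derive_comp_rV (smooth_transition Ad Ad' 1) oU Ux Dcd.
rewrite -(transition_cmap d cp) -E; apply: near_eq_derive.
have : nbhs (cmap c p) (overlap c d).
  by apply: open_nbhs_nbhs; split; [exact: open_overlap|exact: overlap_cmap].
apply: filterS => x [q [cq dq] <-] /=.
by rewrite !transition_cmap.
Qed.

Lemma derive_transition_id (R : realType) (n : nat) (M : topologicalType)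
    (p : M) (c : chart R n M) v : cdom c p ->
  'D_v (transition c c) (cmap c p) = v.
Proof.
move=> cp; rewrite -[RHS](derive_id (cmap c p) v); apply: near_eq_derive.
have : nbhs (cmap c p) (overlap c c).
  by apply: open_nbhs_nbhs; split; [exact: open_overlap|exact: overlap_cmap].
by apply: filterS => x [q [cq dq] <-] /=; rewrite transition_cmap.
Qed.

(** Right multiplication of rows by the Jacobian: in this form linearity and continuity in the
    tangent vector become available. *)
Lemma derive_transition_linear (R : realType) (n : nat) (M : manifold R n)
    (p : M) (c d : chart R n M) v : chart_around p c -> chart_around p d ->
  'D_v (transition c d) (cmap c p) =
  v *m (\matrix_(i, j) 'D_(delta_mx 0 i) (transition c d) (cmap c p) 0 j).
Proof.
move=> [Ac cp] [Ad dp].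
apply: (derive_linear_rV v (smooth_transition Ac Ad 1)).
  exact: open_overlap.
exact: overlap_cmap.
Qed.

Lemma tangent_space0 (R : realType) (n : nat) (M : manifold R n) (p : M) :
  tangent_space p (0 : tangent_vector M).
Proof. by split=> // c d _ _; rewrite derive0. Qed.

Lemma tangent_space_linear (R : realType) (n : nat) (M : manifold R n) (p : M) a
    (u v : tangent_vector M) :
  tangent_space p u -> tangent_space p v -> tangent_space p (a *: u + v).
Proof.
move=> [u0 uE] [v0 vE]; have E c : (a *: u + v) c = a *: u c + v c by [].
split=> [c cp|c d cp dp]; first by rewrite E u0// v0// scaler0 addr0.
rewrite !E (uE _ _ cp dp) (vE _ _ cp dp) !derive_transition_linear//.
by rewrite mulmxDl scalemxAl.
Qed.

(** Each condition defining T_pM is closed: coordinates vanish in the charts not around [p], and in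
    two charts around [p] they are related by a fixed Jacobian. Hence convergence is required in all
    charts. *)
Lemma tangent_space_lim (R : realType) (n : nat) (M : manifold R n) (p : M)
    (T : Type) (F : set_system T) (v : T -> tangent_vector M)
    (l : tangent_vector M) : ProperFilter F ->
  (forall s, tangent_space p (v s)) -> (forall c, v s c @[s --> F] --> l c) ->
  tangent_space p l.
Proof.
move=> FF vT vl; split=> [c cp|c d cp dp].
  have := vl c; rewrite (_ : (fun s => v s c) = fun=> 0).
    by move=> /(cvg_lim (@norm_hausdorff _ _)) <-; rewrite lim_cst.
  by apply/funext => s; have [/(_ _ cp)] := vT s.
rewrite derive_transition_linear//; set J := \matrix_(i, j) _.
apply: (@cvg_unique _ (@norm_hausdorff _ _) (v s d @[s --> F])).
  exact: vl.
rewrite /= (_ : (fun s => v s d) = (fun s => v s c *m J)); last first.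
  apply/funext => s; have [_ vE] := vT s.
  by rewrite (vE _ _ cp dp) derive_transition_linear.
suff cJ : {for l c, continuous (fun y : 'rV[R]_n => y *m J)}.
  exact: (@cvg_comp _ _ _ (fun s => v s c) (fun y => y *m J) _ (nbhs (l c)) _
    (vl c) cJ).
apply/continuous_rVP => j; rewrite /prop_for /continuous_at.
have -> : (fun y : 'rV[R]_n => (y *m J) 0 j) = (fun y => \sum_i y 0 i * J i j).
  by apply/funext => y; rewrite mxE.
rewrite [X in _ --> X]mxE.
apply: (@cvg_big _ _ _ _ _ _ _ (nbhs (l c))) => [|i _].
  exact: add_continuous.
by apply: (@cvgM _ _ (nbhs (l c))); [exact: coord_continuous | exact: cvg_cst].
Qed.

Lemma vector_field0 (R : realType) (n : nat) (M : manifold R n) :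
  vector_field (0 : section M).
Proof.
split=> [p|c _ k]; first exact: tangent_space0.
by apply: Ck_on_cst; exact: open_cimg.
Qed.

Lemma Ck_onZ (R : realType) (V : normedModType R) k (U : set V) m
    (f : V -> R^o) (g : V -> 'rV[R]_m) : open U ->
  Ck_on k U f -> Ck_on k U g -> Ck_on k U (fun x => f x *: g x).
Proof.
move=> oU Cf Cg; apply/Ck_on_rVP => // j.
apply: (@eq_Ck_on _ _ _ _ _ (fun x => f x * g x 0 j : R^o)) => //.
  by move=> x _; rewrite mxE.
by apply: Ck_onM => //; exact: (Ck_on_rVP _ _ oU).1 Cg j.
Qed.

Lemma vector_field_fscaleD (R : realType) (n : nat) (M : manifold R n) (f : M -> R)
    (X Y : section M) : smooth_function f -> vector_field X -> vector_field Y ->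
  vector_field (fscale f X + Y).
Proof.
move=> Cf [XT CX] [YT CY]; split=> [p|c Ac k]; first exact: tangent_space_linear.
apply: (@Ck_onD _ _ _ k (cimg c) (fun x => f (cinv c x) *: X (cinv c x) c)
  (fun x => Y (cinv c x) c)); [exact: open_cimg| |exact: CY].
by apply: Ck_onZ; [exact: open_cimg|exact: Cf|exact: CX].
Qed.

Lemma smooth_function_cst (R : realType) (n : nat) (M : manifold R n) (a : R) :
  smooth_function (fun _ : M => a).
Proof. by move=> c _ k; apply: Ck_on_cst; exact: open_cimg. Qed.

Lemma vector_field_linear (R : realType) (n : nat) (M : manifold R n) (a : R)
    (X Y : section M) : vector_field X -> vector_field Y ->
  vector_field (a *: X + Y).
Proof.
have -> : a *: X = fscale (fun=> a) X by [].
by apply: vector_field_fscaleD; exact: smooth_function_cst.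
Qed.

Lemma vector_field_fscale (R : realType) (n : nat) (M : manifold R n)
    (f : M -> R) (X : section M) : smooth_function f -> vector_field X ->
  vector_field (fscale f X).
Proof.
move=> Cf CX; rewrite -[fscale f X]addr0; apply: vector_field_fscaleD => //.
exact: vector_field0.
Qed.

Lemma vector_field_sum (R : realType) (n : nat) (M : manifold R n) (I : Type)
    (s : seq I) (f : I -> M -> R) (X : I -> section M) :
  (forall i, smooth_function (f i)) -> (forall i, vector_field (X i)) ->
  vector_field (\sum_(i <- s) fscale (f i) (X i)).
Proof.
move=> Cf CX; elim: s => [|i s IH]; first by rewrite big_nil; exact: vector_field0.
by rewrite big_cons; exact: vector_field_fscaleD.
Qed.

Lemma section_sumE (R : realType) (n : nat) (M : manifold R n) (I : Type)
    (s : seq I) (X : I -> section M) p c :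
  (\sum_(i <- s) X i) p c = \sum_(i <- s) X i p c.
Proof.
elim: s => [|i s IH]; first by rewrite !big_nil.
by rewrite !big_cons -IH.
Qed.

(** * Cutoff functions and frames *)

(** As [K] lies in [cdom c], the image of [d] is covered by two open sets: the overlap with [c], and
    the points outside [K], where [f] vanishes. *)
Lemma Ck_on_glue (R : realType) (n : nat) (M : manifold R n)
    (W : normedModType R) (c d : chart R n M) (K : set M) k
    (f : 'rV[R]_n -> W) :
  closed K -> K `<=` cdom c -> Ck_on k (overlap d c) f ->
  (forall x, cimg d x -> ~ K (cinv d x) -> f x = 0) -> Ck_on k (cimg d) f.
Proof.
move=> clK Kc Cf f0.
have C0 : Ck_on k (cimg d `&` cinv d @^-1` (~` K)) f.
  have oK : open (cimg d `&` cinv d @^-1` (~` K)).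
    by apply: open_cimg_preimage; exact: closed_openC.
  apply: (@eq_Ck_on _ _ _ _ _ (fun=> 0)) => //; last exact: Ck_on_cst.
  by move=> x [dx Kx]; rewrite f0.
apply: Ck_on_sub (Ck_on_setU Cf C0) => x dx.
have [Kx|Kx] := pselect (K (cinv d x)); last by right.
by left; apply/overlapP; split=> //; exact: Kc.
Qed.

Lemma Ck_on_overlap (R : realType) (n : nat) (M : manifold R n)
    (c d : chart R n M) k (u : M -> R) : atlas c -> atlas d ->
  Ck_on k (cimg c) (u \o cinv c : 'rV[R]_n -> R^o) ->
  Ck_on k (overlap d c) (u \o cinv d : 'rV[R]_n -> R^o).
Proof.
move=> Ac Ad Cu; have oU := @open_overlap _ _ _ d c.
apply: (@eq_Ck_on _ _ _ _ _
  ((u \o cinv c : 'rV[R]_n -> R^o) \o transition d c)) => //.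
  by move=> x /overlapP[_ cx] /=; rewrite /transition /= cmapK.
apply: (Ck_on_comp oU (@open_cimg _ _ _ c)) => //; last exact: smooth_transition.
by move=> x /overlapP[_ cx]; exists (cinv d x).
Qed.

(* The cutoff is 1 near p, and not only at p, as extends_coordinate_field
   prescribes the fields on a neighbourhood of p. *)
Record cutoff (R : realType) (n : nat) (M : manifold R n) (c : chart R n M)
    (p : M) := Cutoff {
  csupp : set M;
  cutf :> M -> R;
  csupp_closed : closed csupp;
  csupp_dom : csupp `<=` cdom c;
  cut0 : forall q, ~ csupp q -> cutf q = 0;
  cut1 : \forall q \near p, cutf q = 1;
  cut_smooth : smooth_on (cimg c) (cutf \o cinv c : 'rV[R]_n -> R^o) }.

Lemma ex_cutoff (R : realType) (n : nat) (M : manifold R n) (c : chart R n M)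
    (p : M) : atlas c -> cdom c p -> inhabited (cutoff c p).
Proof.
move=> Ac cp; set a := cmap c p.
have [s s0 sc] : exists2 s : R, 0 < s &
    forall x : 'rV[R]_n, (forall i, `|x 0 i - a 0 i| <= s) -> cimg c x.
  apply: nbhs_box; apply: open_nbhs_nbhs; split; first exact: open_cimg.
  by exists p.
(* The bump can be nonzero up to distance 2 r from [a], which must stay inside the image of the
   chart. *)
pose r := s / 2; have r0 : 0 < r by rewrite divr_gt0.
have rs : 2 * r = s by rewrite /r; field.
pose box := [set x : 'rV[R]_n | forall i, `|x 0 i - a 0 i| <= 2 * r].
have boxc x : box x -> cimg c x by rewrite /box /= rs => /sc.
(* Outside [cdom c] the value of [cmap c] is arbitrary, so 0 is imposed there. *)
pose chi q : R := if `[< cdom c q >] then box_bump a r (cmap c q) else 0.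
constructor; apply: (@Cutoff _ _ _ c p (cinv c @` box) chi).
  (* the support is the image of a compact box, closed as M is Hausdorff *)
- apply: compact_closed; first exact: manifold_hausdorff.
  apply: continuous_compact; last exact: compact_box.
  apply: continuous_in_subspaceT => x /set_mem/boxc.
  exact: cinv_continuous.
- by move=> _ [x /boxc/cinv_cimg[cx _] <-].
- move=> q nKq; rewrite /chi; case: asboolP => // cq.
  apply/eqP/negPn/negP => /(box_bump0 r0) b; apply: nKq.
  by exists (cmap c q); rewrite ?cmapK.
- have nc : nbhs p (cdom c) by apply: open_nbhs_nbhs; split=> //; exact: cdom_open.
  have nb := cmap_continuous cp (near_box a r0).
  near=> q; rewrite /chi asboolT; last by near: q.
  by apply: box_bump1 => //; near: q.
- move=> k; apply: (@eq_Ck_on _ _ _ _ _ (box_bump a r : 'rV[R]_n -> R^o)).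
  + exact: open_cimg.
  + by move=> x /cinv_cimg[cx E]; rewrite /= /chi asboolT// E.
  + by apply: Ck_on_sub (Ck_on_box_bump a r k).
Unshelve. all: by end_near. Qed.

Lemma cut_notin_cdom (R : realType) (n : nat) (M : manifold R n)
    (c : chart R n M) (p : M) (chi : cutoff c p) q : ~ cdom c q -> chi q = 0.
Proof. by move=> cq; apply: cut0 => /csupp_dom. Qed.

(** Globalizes functions that are smooth in the chart [c] only, such as the coordinates of a vector
    field in [c]. *)
Lemma smooth_cutoffM (R : realType) (n : nat) (M : manifold R n)
    (c : chart R n M) (p : M) (chi : cutoff c p) (u : M -> R) : atlas c ->
  smooth_on (cimg c) (u \o cinv c : 'rV[R]_n -> R^o) ->
  smooth_function (fun q => chi q * u q).
Proof.
move=> Ac Cu d Ad k; apply: (Ck_on_glue (@csupp_closed _ _ _ _ _ chi)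
    (@csupp_dom _ _ _ _ _ chi)).
  apply: (@Ck_onM _ _ _ _ (chi \o cinv d) (u \o cinv d)).
  - exact: open_overlap.
  - by apply: Ck_on_overlap => //; exact: cut_smooth.
  - exact: Ck_on_overlap.
by move=> x _ Kx; rewrite /= cut0// mul0r.
Qed.

(* The field chi d/dx^i, extended by 0 outside cdom c. *)
Definition frame (R : realType) (n : nat) (M : manifold R n)
    (c : chart R n M) (p : M) (chi : cutoff c p) (i : 'I_n) : section M :=
  fun q d => if `[< chart_around q d /\ cdom c q >]
    then chi q *: 'D_(delta_mx 0 i) (transition c d) (cmap c q) else 0.

(** Tangency is the chain rule for transition maps, the scalar [chi q] passing through the Jacobian.
    Smoothness in a chart [d] is that of the derivative of a transition map on the overlap, glued
    with 0 off the support. *)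
Lemma frame_field (R : realType) (n : nat) (M : manifold R n)
    (c : chart R n M) (p : M) (chi : cutoff c p) i : atlas c ->
  vector_field (frame chi i).
Proof.
move=> Ac; split=> [q|d Ad k].
  split=> [d dq|d d' dq d'q]; first by rewrite /frame asboolF// => -[].
  rewrite /frame; have [cq|cq] := pselect (cdom c q); last first.
    by rewrite asboolF ?asboolF ?derive0// => -[].
  rewrite !asboolT//; have cq' : chart_around q c by [].
  rewrite (derive_transition_comp _ cq' dq d'q).
  rewrite (derive_transition_linear (chi q *: _))//.
  by rewrite (derive_transition_linear ('D_ _ _ _))// scalemxAl.
apply: (Ck_on_glue (@csupp_closed _ _ _ _ _ chi)
    (@csupp_dom _ _ _ _ _ chi)); last first.
  by move=> x _ Kx; rewrite /frame; case: asboolP => // _; rewrite cut0// scale0r.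
have oU := @open_overlap _ _ _ d c.
apply: (@eq_Ck_on _ _ _ _ _ (fun x => (chi \o cinv d) x *:
    ('D_(delta_mx 0 i) (transition c d) \o transition d c) x)) => //.
  move=> x /overlapP[dx cx]; rewrite /frame asboolT//.
  by split=> //; split=> //; have [] := cinv_cimg dx.
apply: Ck_onZ => //; first by apply: Ck_on_overlap => //; exact: cut_smooth.
apply: (Ck_on_comp_rV (U' := overlap c d) oU).
- exact: open_overlap.
- move=> x /overlapP[dx cx]; apply: overlap_cmap => //.
  by have [] := cinv_cimg dx.
- exact: smooth_transition.
- by apply: Ck_on_derive; exact: smooth_transition.
Qed.

Lemma frame_extends (R : realType) (n : nat) (M : manifold R n)
    (c : chart R n M) (p : M) (chi : cutoff c p) i : atlas c -> cdom c p ->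
  extends_coordinate_field c i p (frame chi i).
Proof.
move=> Ac cp; split; first exact: frame_field.
have nc : nbhs p (cdom c) by apply: open_nbhs_nbhs; split=> //; exact: cdom_open.
have n1 := cut1 chi; near=> q.
have cq : cdom c q by near: q.
rewrite /frame asboolT// derive_transition_id//.
by rewrite (_ : cutf chi q = 1) ?scale1r//; near: q.
Unshelve. all: by end_near. Qed.

Lemma cut_coord_smooth (R : realType) (n : nat) (M : manifold R n)
    (c : chart R n M) (p : M) (chi : cutoff c p) (X : section M) i : atlas c ->
  vector_field X -> smooth_function (fun q => chi q * X q c 0 i).
Proof.
move=> Ac [_ CX]; apply: smooth_cutoffM => // k.
exact: (Ck_on_rVP k _ (@open_cimg _ _ _ c)).1 (CX c Ac k) i.
Qed.

(** Over [cdom c], this is the expansion of [X q c] in the standard basis, carried to [d] by the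
    Jacobian. Elsewhere both sides vanish: through [chi] outside [cdom c], by convention in charts
    not around [q]. *)
Lemma cut_frame (R : realType) (n : nat) (M : manifold R n)
    (c : chart R n M) (p : M) (chi : cutoff c p) (X : section M) : atlas c ->
  vector_field X ->
  fscale (fun q => chi q * chi q) X =
  \sum_i fscale (fun q => chi q * X q c 0 i) (frame chi i).
Proof.
move=> Ac [TX CX]; apply/funext => q; apply/funext => d; rewrite section_sumE.
have [X0 XE] := TX q.
have -> : fscale (fun q => chi q * chi q) X q d = (chi q * chi q) *: X q d by [].
have -> : \sum_i fscale (fun q => chi q * X q c 0 i) (frame chi i) q d =
  \sum_i (chi q * X q c 0 i) *: frame chi i q d by [].
have [dq|dq] := pselect (chart_around q d); last first.
  by rewrite X0// scaler0 big1// => i _; rewrite /frame asboolF ?scaler0// => -[].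
have [cq|cq] := pselect (cdom c q); last first.
  by rewrite cut_notin_cdom// mul0r scale0r big1// => i _; rewrite mul0r scale0r.
have cq' : chart_around q c by [].
rewrite (XE _ _ cq' dq) derive_transition_linear//.
rewrite {1}[X q c]row_sum_delta mulmx_suml scaler_sumr; apply: eq_bigr => i _.
rewrite /frame asboolT// (derive_transition_linear (delta_mx 0 i))//.
by rewrite -scalemxAl !scalerA mulrAC.
Qed.

(** * Components of tensor fields *)

(** The linearity law with [f] = 1 and zero fields reads B(0, Y) = B(0, Y) + B(0, Y). It separates
    scaling from addition in that law. *)
Lemma tensor_0l (R : realType) (n : nat) (M : manifold R n) (B : tensor21 M)
    (Y : section M) : vector_field Y -> B 0 Y = 0.
Proof.
move=> CY; have C0 := vector_field0 M.
have := tensor_linear_l B (@smooth_function_cst _ _ M 1) C0 C0 CY.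
have E X : fscale (fun=> 1) X = X :> section M.
  by apply/funext => p; rewrite /fscale scale1r.
by rewrite !E addr0 => /(congr1 (fun Z => Z - B 0 Y)); rewrite subrr addrK.
Qed.

Lemma tensor_0r (R : realType) (n : nat) (M : manifold R n) (B : tensor21 M)
    (X : section M) : vector_field X -> B X 0 = 0.
Proof.
move=> CX; have C0 := vector_field0 M.
have := tensor_linear_r B (@smooth_function_cst _ _ M 1) CX C0 C0.
have E Z : fscale (fun=> 1) Z = Z :> section M.
  by apply/funext => p; rewrite /fscale scale1r.
by rewrite !E addr0 => /(congr1 (fun Z => Z - B X 0)); rewrite subrr addrK.
Qed.

Lemma tensor_fscalel (R : realType) (n : nat) (M : manifold R n)
    (B : tensor21 M) (f : M -> R) (X Y : section M) : smooth_function f ->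
  vector_field X -> vector_field Y -> B (fscale f X) Y = fscale f (B X Y).
Proof.
move=> Cf CX CY; rewrite -[fscale f X]addr0 tensor_linear_l//.
  by rewrite tensor_0l// addr0.
exact: vector_field0.
Qed.

Lemma tensor_fscaler (R : realType) (n : nat) (M : manifold R n)
    (B : tensor21 M) (f : M -> R) (X Y : section M) : smooth_function f ->
  vector_field X -> vector_field Y -> B X (fscale f Y) = fscale f (B X Y).
Proof.
move=> Cf CX CY; rewrite -[fscale f Y]addr0 tensor_linear_r//.
  by rewrite tensor_0r// addr0.
exact: vector_field0.
Qed.

Lemma tensor_suml (R : realType) (n : nat) (M : manifold R n) (B : tensor21 M)
    (I : Type) (s : seq I) (f : I -> M -> R) (X : I -> section M)
    (Y : section M) : (forall i, smooth_function (f i)) ->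
  (forall i, vector_field (X i)) -> vector_field Y ->
  B (\sum_(i <- s) fscale (f i) (X i)) Y = \sum_(i <- s) fscale (f i) (B (X i) Y).
Proof.
move=> Cf CX CY; elim: s => [|i s IH]; first by rewrite !big_nil tensor_0l.
by rewrite !big_cons tensor_linear_l// ?IH//; exact: vector_field_sum.
Qed.

Lemma tensor_sumr (R : realType) (n : nat) (M : manifold R n) (B : tensor21 M)
    (I : Type) (s : seq I) (f : I -> M -> R) (X : section M)
    (Y : I -> section M) : (forall i, smooth_function (f i)) ->
  vector_field X -> (forall i, vector_field (Y i)) ->
  B X (\sum_(i <- s) fscale (f i) (Y i)) = \sum_(i <- s) fscale (f i) (B X (Y i)).
Proof.
move=> Cf CX CY; elim: s => [|i s IH]; first by rewrite !big_nil tensor_0r.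
by rewrite !big_cons tensor_linear_r// ?IH//; exact: vector_field_sum.
Qed.

(** Multiplying both arguments by chi^2 multiplies the value by chi^4, which is 1 at [p]. The
    expanded side involves only frame fields, and these extend the coordinate fields near [p], so
    [coefficients] gives their values. *)
Lemma tensor_coord (R : realType) (n : nat) (M : manifold R n) (B : tensor21 M)
    (c : chart R n M) (G : 'I_n -> 'I_n -> 'I_n -> 'rV[R]_n -> R) (p : M)
    (X Y : section M) (k : 'I_n) :
  atlas c -> coefficients B c G -> cdom c p -> vector_field X -> vector_field Y ->
  B X Y p c 0 k =
  \sum_i \sum_j X p c 0 i * Y p c 0 j * G i j k (cmap c p).
Proof.
move=> Ac BG cp CX CY; have [chi] := ex_cutoff Ac cp.
have chip : chi p = 1 by exact: nbhs_singleton (cut1 chi).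
pose E := frame chi; have CE i : vector_field (E i) by exact: frame_field.
pose fX (Z : section M) (i : 'I_n) (q : M) : R := chi q * Z q c 0 i.
have Cf Z i : vector_field Z -> smooth_function (fX Z i) by exact: cut_coord_smooth.
have C2 : smooth_function (fun q => chi q * chi q).
  by apply: smooth_cutoffM => //; exact: cut_smooth.
have EB : fscale (fun q => chi q * chi q)
      (fscale (fun q => chi q * chi q) (B X Y)) =
    \sum_i fscale (fX X i) (\sum_j fscale (fX Y j) (B (E i) (E j))).
  rewrite -tensor_fscaler// -tensor_fscalel//; last exact: vector_field_fscale.
  rewrite !(cut_frame chi)// tensor_suml//.
  - by apply: eq_bigr => i _; rewrite tensor_sumr// => j; exact: Cf.
  - by move=> i; exact: Cf.
  - by apply: vector_field_sum => // j; exact: Cf.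
have := congr1 (fun Z : section M => Z p c 0 k) EB.
rewrite [LHS](_ : _ = B X Y p c 0 k); last first.
  by rewrite !mxE chip !mul1r.
move=> ->; rewrite section_sumE summxE; apply: eq_bigr => i _.
rewrite [LHS](_ : _ =
  fX X i p * (\sum_j fscale (fX Y j) (B (E i) (E j))) p c 0 k); last first.
  by rewrite mxE.
rewrite section_sumE summxE mulr_sumr; apply: eq_bigr => j _.
rewrite [X in _ * X = _](_ : _ = fX Y j p * B (E i) (E j) p c 0 k); last first.
  by rewrite mxE.
rewrite (BG p cp i j _ _ (frame_extends chi i Ac cp)
  (frame_extends chi j Ac cp) k).
by rewrite /fX chip !mul1r mulrA.
Qed.

(** * Difference quotients of connections *)

Lemma vector_field_sub (R : realType) (n : nat) (M : manifold R n) (a : R)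
    (X Y : section M) : vector_field X -> vector_field Y ->
  vector_field (a *: (X - Y)).
Proof.
move=> CX CY; rewrite -[X in vector_field X]addr0.
apply: vector_field_linear; last exact: vector_field0.
rewrite addrC -scaleN1r; exact: vector_field_linear.
Qed.

(** The difference quotient is the case [a] = 1/e. An arbitrary scalar keeps the condition that e be
    nonzero out of the algebra. *)
Definition scaled_diff (R : realType) (n : nat) (M : manifold R n) (a : R)
  (D D' : connection M) (X Y : section M) : section M := a *: (D X Y - D' X Y).

Lemma scaled_diff_field (R : realType) (n : nat) (M : manifold R n) (a : R)
    (D D' : connection M) (X Y : section M) : vector_field X -> vector_field Y ->
  vector_field (scaled_diff a D D' X Y).
Proof. by move=> CX CY; apply: vector_field_sub; exact: cov_field. Qed.

Lemma scaled_diff_linear_l (R : realType) (n : nat) (M : manifold R n) (a : R)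
    (D D' : connection M) f (X X' Y : section M) : smooth_function f ->
  vector_field X -> vector_field X' -> vector_field Y ->
  scaled_diff a D D' (fscale f X + X') Y =
  fscale f (scaled_diff a D D' X Y) + scaled_diff a D D' X' Y.
Proof.
move=> Cf CX CX' CY; rewrite /scaled_diff !cov_linear_l//.
apply/funext => p; apply/funext => c; apply/rowP => k.
do !rewrite ?mxE /=; ring.
Qed.

Lemma scaled_diff_linear_r (R : realType) (n : nat) (M : manifold R n) (a : R)
    (D D' : connection M) f (X Y Y' : section M) : smooth_function f ->
  vector_field X -> vector_field Y -> vector_field Y' ->
  scaled_diff a D D' X (fscale f Y + Y') =
  fscale f (scaled_diff a D D' X Y) + scaled_diff a D D' X Y'.
Proof.
move=> Cf CX CY CY'; have CfY := vector_field_fscale Cf CY.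
have E (C : connection M) : C X (fscale f Y + Y') =
    fscale (field_derive X f) Y + fscale f (C X Y) + C X Y'.
  by have := cov_linear_r C 1 CX CfY CY'; rewrite !scale1r cov_leibniz.
rewrite /scaled_diff !E.
apply/funext => p; apply/funext => c; apply/rowP => k.
do !rewrite ?mxE /=; ring.
Qed.

Definition scaled_diff_tensor (R : realType) (n : nat) (M : manifold R n)
  (a : R) (D D' : connection M) : tensor21 M :=
  Tensor21 (@scaled_diff_field _ _ _ a D D') (@scaled_diff_linear_l _ _ _ a D D')
    (@scaled_diff_linear_r _ _ _ a D D').

Lemma scaled_diff_coefficients (R : realType) (n : nat) (M : manifold R n)
    (a : R) (D D' : connection M) (c : chart R n M) G G' :
  coefficients D c G -> coefficients D' c G' ->
  coefficients (scaled_diff_tensor a D D') c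
    (fun i j k x => a * (G i j k x - G' i j k x)).
Proof.
move=> DG DG' p cp i j X Y EX EY k.
rewrite -(DG p cp i j X Y EX EY k) -(DG' p cp i j X Y EX EY k).
by rewrite /= /scaled_diff !mxE.
Qed.

(** * The limit of the difference quotients *)

(** The partial derivative in time is taken as a directional derivative on R x R^n, so that its
    joint smoothness in time and space is part of the smoothness of [G]. *)
Definition time_derivative (R : realType) (n : nat)
    (G : 'I_n -> 'I_n -> 'I_n -> R * 'rV[R]_n -> R) (t : R)
    (i j k : 'I_n) (x : 'rV[R]_n) : R :=
  'D_((1 : R^o), (0 : 'rV[R]_n)) (G i j k : (R^o * 'rV[R]_n)%type -> R^o) (t, x).

(* In a chart that is not around p the quotients are 0, hence so is the limit. *)
Definition Gamma_dot (R : realType) (n : nat) (M : manifold R n)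
    (nabla : R -> connection M) (t : R) (X Y : section M) : section M :=
  fun p c => lim (scaled_diff_tensor e^-1 (nabla (t + e)) (nabla t) X Y p c
    @[e --> (0 : R)^']).

Lemma cvg_coord_rV (R : realType) (T : Type) (F : set_system T) m
    (f : T -> 'rV[R]_m) (l : 'rV[R]_m) : Filter F ->
  (forall k, f s 0 k @[s --> F] --> l 0 k) -> f s @[s --> F] --> l.
Proof.
move=> FF fl A [P lP sPA]; rewrite /= nbhs_filterE; near=> s; apply: sPA => i k.
rewrite ord1; move: k; near: s; apply: filter_forall => k; apply: fl.
exact: lP.
Unshelve. all: by end_near. Qed.

Lemma cvg_time_derivative (R : realType) (n : nat)
    (U : set 'rV[R]_n) (G : 'I_n -> 'I_n -> 'I_n -> R * 'rV[R]_n -> R) t x i j k :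
  smooth_on ([set: R] `*` U) (G i j k : (R^o * 'rV[R]_n)%type -> R^o) -> U x ->
  e^-1 * (G i j k (t + e, x) - G i j k (t, x)) @[e --> (0 : R)^'] -->
    time_derivative G t i j k x.
Proof.
move=> CG Ux; have TUx : ([set: R] `*` U) (t, x) by [].
have [d _] := Ck_on_is_derive ((1 : R^o), (0 : 'rV[R]_n)) (CG 1%N) TUx.
apply: cvg_trans (d : _ --> _); apply: near_eq_cvg; near=> h.
rewrite /=; congr (_ * (G i j k _ - _)).
by congr (_, _); rewrite /= ?scaler0 ?add0r// [_ *: _]mulr1 addrC.
Unshelve. all: by end_near. Qed.

Lemma cvg_quotient_coord (R : realType) (n : nat) (M : manifold R n)
    (nabla : R -> connection M) (c : chart R n M) G t (X Y : section M) (p : M) :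
  atlas c -> (forall t, coefficients (nabla t) c (fun i j k x => G i j k (t, x))) ->
  (forall i j k, smooth_on ([set: R] `*` cimg c)
     (G i j k : (R^o * 'rV[R]_n)%type -> R^o)) ->
  vector_field X -> vector_field Y -> cdom c p ->
  scaled_diff_tensor e^-1 (nabla (t + e)) (nabla t) X Y p c @[e --> (0 : R)^'] -->
  \row_k \sum_i \sum_j X p c 0 i * Y p c 0 j * time_derivative G t i j k (cmap c p).
Proof.
move=> Ac cG CG CX CY cp; apply: cvg_coord_rV => k; rewrite mxE.
have E e := tensor_coord k Ac
  (scaled_diff_coefficients e^-1 (cG (t + e)) (cG t)) cp CX CY.
rewrite (_ : (fun e => _) = fun e => \sum_i \sum_j X p c 0 i * Y p c 0 j *
  (e^-1 * (G i j k (t + e, cmap c p) - G i j k (t, cmap c p)))); last exact/funext.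
apply: (@cvg_big _ _ _ _ _ _ _ (0 : R)^') => [|i _]; first exact: add_continuous.
apply: (@cvg_big _ _ _ _ _ _ _ (0 : R)^') => [|j _]; first exact: add_continuous.
apply: (@cvgM _ _ (0 : R)^'); first exact: cvg_cst.
by apply: cvg_time_derivative; [exact: CG | exists p].
Qed.

Lemma Gamma_dot_unique (R : realType) (n : nat) (M : manifold R n)
    (nabla : R -> connection M) t (X Y : section M) (p : M) (c : chart R n M)
    (l : 'rV[R]_n) :
  scaled_diff_tensor e^-1 (nabla (t + e)) (nabla t) X Y p c
    @[e --> (0 : R)^'] --> l ->
  Gamma_dot nabla t X Y p c = l.
Proof. exact: (cvg_lim (@norm_hausdorff _ _)). Qed.

(** Charts not around [p] are included, since membership of the limit in T_pM and equality of
    sections are tested in every chart. *)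
Lemma cvg_Gamma_dot (R : realType) (n : nat) (M : manifold R n)
    (nabla : R -> connection M) t (X Y : section M) (p : M) (c : chart R n M) :
  smooth_family (fun t => nabla t) -> vector_field X -> vector_field Y ->
  scaled_diff_tensor e^-1 (nabla (t + e)) (nabla t) X Y p c @[e --> (0 : R)^'] -->
  Gamma_dot nabla t X Y p c.
Proof.
move=> hnabla CX CY.
suff [l Hl] : exists l, scaled_diff_tensor e^-1 (nabla (t + e)) (nabla t) X Y p c
    @[e --> (0 : R)^'] --> (l : 'rV[R]_n) by apply/cvg_ex; exists l.
have [[Ac cp]|cp] := pselect (chart_around p c).
  have [G [cG CG]] := hnabla c Ac.
  by eexists; exact: cvg_quotient_coord cG CG CX CY cp.
exists 0; rewrite (_ : (fun e => _) = fun=> 0); first exact: cvg_cst.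
apply/funext => e.
by have [/(_ p)[/(_ c cp)]] :=
  tensor_field (scaled_diff_tensor e^-1 (nabla (t + e)) (nabla t)) CX CY.
Qed.

Lemma Gamma_dot_coord (R : realType) (n : nat) (M : manifold R n)
    (nabla : R -> connection M) (c : chart R n M) G t (X Y : section M) (p : M) :
  atlas c -> (forall t, coefficients (nabla t) c (fun i j k x => G i j k (t, x))) ->
  (forall i j k, smooth_on ([set: R] `*` cimg c)
     (G i j k : (R^o * 'rV[R]_n)%type -> R^o)) ->
  vector_field X -> vector_field Y -> cdom c p ->
  Gamma_dot nabla t X Y p c =
  \row_k \sum_i \sum_j X p c 0 i * Y p c 0 j * time_derivative G t i j k (cmap c p).
Proof.
move=> Ac cG CG CX CY cp; apply: Gamma_dot_unique.
exact: cvg_quotient_coord cG CG CX CY cp.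
Qed.

Lemma Ck_on_slice (R : realType) (n : nat) (W : normedModType R) k
    (U : set 'rV[R]_n) (f : (R^o * 'rV[R]_n)%type -> W) (t : R) :
  Ck_on k ([set: R] `*` U) f -> Ck_on k U (fun x => f (t, x)).
Proof.
move=> Cf; rewrite (_ : U = (fun x => (t : R^o, x)) @^-1` ([set: R] `*` U)).
  apply: (Ck_on_affine (L := fun u => (0 : R^o, u)) _ _ Cf).
    move=> x; apply: (@cvg_pair _ _ _ (nbhs x) (nbhs (t : R^o)) (nbhs x)).
      exact: cvg_cst.
    exact: cvg_id.
  by move=> h u y; congr (_, _); rewrite /= scaler0 add0r.
by apply/seteqP; split=> x //= [].
Qed.

Lemma Gamma_dot_field (R : realType) (n : nat) (M : manifold R n)
    (nabla : R -> connection M) t (X Y : section M) :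
  smooth_family (fun t => nabla t) -> vector_field X -> vector_field Y ->
  vector_field (Gamma_dot nabla t X Y).
Proof.
move=> hnabla CX CY; split=> [p|c Ac k].
  apply: (tangent_space_lim (F := (0 : R)^') (v := fun e =>
    scaled_diff_tensor e^-1 (nabla (t + e)) (nabla t) X Y p)) => [e|c].
    exact: (tensor_field (scaled_diff_tensor _ _ _) CX CY).1.
  exact: cvg_Gamma_dot.
have [G [cG CG]] := hnabla c Ac; have oU := @open_cimg _ _ _ c.
apply/Ck_on_rVP => // m.
apply: (@eq_Ck_on _ _ _ _ _ (fun x => \sum_i \sum_j
    X (cinv c x) c 0 i * Y (cinv c x) c 0 j *
    time_derivative G t i j m x : R^o)) => //.
  move=> x cx; have [cx' xE] := cinv_cimg cx.
  by rewrite (Gamma_dot_coord t Ac cG CG CX CY cx') mxE xE.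
apply: Ck_on_sum => // i; apply: Ck_on_sum => // j.
have CZ Z a : vector_field Z ->
    Ck_on k (cimg c) (fun x => Z (cinv c x) c 0 a : R^o).
  by move=> [_ CZ]; exact: (Ck_on_rVP k _ oU).1 (CZ c Ac k) a.
apply: Ck_onM => //; first by apply: Ck_onM => //; exact: CZ.
apply: (Ck_on_slice (f := 'D_((1 : R^o), (0 : 'rV[R]_n))
  (G i j m : (R^o * 'rV[R]_n)%type -> R^o))).
exact/Ck_on_derive/CG.
Qed.

Lemma Gamma_dot_linear_l (R : realType) (n : nat) (M : manifold R n)
    (nabla : R -> connection M) t f (X X' Y : section M) :
  smooth_family (fun t => nabla t) -> smooth_function f ->
  vector_field X -> vector_field X' -> vector_field Y ->
  Gamma_dot nabla t (fscale f X + X') Y =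
  fscale f (Gamma_dot nabla t X Y) + Gamma_dot nabla t X' Y.
Proof.
move=> hnabla Cf CX CX' CY; apply/funext => p; apply/funext => c.
apply: Gamma_dot_unique.
under eq_fun do rewrite tensor_linear_l//.
apply: (@cvgD _ _ _ (0 : R)^'); last exact: cvg_Gamma_dot.
exact: (@cvgZ _ _ _ (0 : R)^' _ (fun=> f p) _ _ _ (cvg_cst _)
  (cvg_Gamma_dot hnabla CX CY)).
Qed.

Lemma Gamma_dot_linear_r (R : realType) (n : nat) (M : manifold R n)
    (nabla : R -> connection M) t f (X Y Y' : section M) :
  smooth_family (fun t => nabla t) -> smooth_function f ->
  vector_field X -> vector_field Y -> vector_field Y' ->
  Gamma_dot nabla t X (fscale f Y + Y') =
  fscale f (Gamma_dot nabla t X Y) + Gamma_dot nabla t X Y'.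
Proof.
move=> hnabla Cf CX CY CY'; apply/funext => p; apply/funext => c.
apply: Gamma_dot_unique.
under eq_fun do rewrite tensor_linear_r//.
apply: (@cvgD _ _ _ (0 : R)^'); last exact: cvg_Gamma_dot.
exact: (@cvgZ _ _ _ (0 : R)^' _ (fun=> f p) _ _ _ (cvg_cst _)
  (cvg_Gamma_dot hnabla CX CY)).
Qed.

Definition Gamma_dot_tensor (R : realType) (n : nat) (M : manifold R n)
    (nabla : R -> connection M) (hnabla : smooth_family (fun t => nabla t))
    (t : R) : tensor21 M :=
  Tensor21 (fun X Y => @Gamma_dot_field _ _ _ nabla t X Y hnabla)
    (fun f X X' Y => @Gamma_dot_linear_l _ _ _ nabla t f X X' Y hnabla)
    (fun f X Y Y' => @Gamma_dot_linear_r _ _ _ nabla t f X Y Y' hnabla).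

Theorem proposition6p3 (R : realType) (n : nat) (M : manifold R n)
    (nabla : R -> connection M) (hnabla : smooth_family (fun t => nabla t)) :
  exists Gdot : R -> tensor21 M,
    smooth_family (fun t => Gdot t) /\
    forall (t : R) (X Y : section M), vector_field X -> vector_field Y ->
    forall p : M,
      tangent_cvg p (0 : R)^'
        (fun e : R => e^-1 *: (nabla (t + e) X Y p - nabla t X Y p))
        (Gdot t X Y p).
Proof.
exists (Gamma_dot_tensor hnabla); split; last first.
  by move=> t X Y CX CY p c _; exact: cvg_Gamma_dot.
move=> c Ac; have [G [cG CG]] := hnabla c Ac.
(* The components are the time derivatives of the Christoffel symbols of the family. *)
exists (fun i j k tx => time_derivative G tx.1 i j k tx.2); split; last first.
  move=> i j k m.
  rewrite (_ : (fun tx => _) = 'D_((1 : R^o), (0 : 'rV[R]_n))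
    (G i j k : (R^o * 'rV[R]_n)%type -> R^o)); first exact/Ck_on_derive/CG.
  by apply/funext => -[s x].
move=> t p cp i j X Y [CX nX] [CY nY] k.
rewrite /= (Gamma_dot_coord t Ac cG CG CX CY cp) mxE.
(* At [p] the coordinates of [X] and [Y] are basis rows, so only the term (i, j) of the double sum
   survives. *)
rewrite (nbhs_singleton nX) (nbhs_singleton nY).
rewrite (bigD1 i)//= (bigD1 j)//= !mxE !eqxx !mul1r !big1 ?addr0//.
  by move=> l /negPf li; rewrite big1// => m _; rewrite mxE eqxx li !mul0r.
by move=> l /negPf lj; rewrite [X in _ * X * _]mxE eqxx lj mulr0 mul0r.
Qed.
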